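(* Let $G$ be a discrete free Fuchsian group of rank two with invariant disc $\Delta$, without parabolic elements, whose generators have disjoint axes; let $A,B$ be stopping generators and let $H=\mathbb H^3/G$. For each $s>0$, the surface $$\mathcal S(s)=N_{ext}(s)\cup N_{int}(s)\cup F_A(s)\cup F_B(s)\cup F_{A^{-1}B}(s)\subset H$$ is invariant under the hyperelliptic isometry $j:H\to H$.
   Context: $\mathbb H^3$ is upper half-space with boundary $\hat{\mathbb C}$; $\Delta=\{|z|<1\}$; $\mathbb P\subset\mathbb H^3$ is the hyperbolic plane with boundary $\partial\Delta$. $G$ acts on $\mathbb H^3$ preserving $\mathbb P$ and each of its two sides (the exterior side faces $\{|z|>1\}$, the interior side faces $\Delta$). $Ax_W$ denotes the axis of $W\in G$ in $\mathbb H^3$; it lies in $\mathbb P$. For a hyperbolic line $M$, $H_M$ is the half-turn about $M$. Stopping generators: generators $A,B$ of $G$ with disjoint axes; $L\subset\mathbb P$ is the line orthogonal to $Ax_A$ and $Ax_B$, and $L_A,L_B\subset\mathbb P$ are the lines with $A=H_LH_{L_A}$, $B=H_LH_{L_B}$; the pair is stopping if $L,L_A,L_B$ bound a domain in $\mathbb P$ (none separates the other two). The involution $j$: $G$ is a normal subgroup of index two in $\langle H_L,H_{L_A},H_{L_B}\rangle$, and $H_L,H_{L_A},H_{L_B}$ differ by elements of $G$; $j:H\to H$ is the order two isometry they all induce. The surface $\mathcal S(s)$: $\mathcal C\subset\mathbb P$ is the hyperbolic convex hull in $\mathbb H^3$ of the limit set of $G$. For $x\in\mathbb P$ let $V_x(t)$,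 $t\in\mathbb R$, be the arclength-parameterized line orthogonal to $\mathbb P$ with $V_x(0)=x$, directed so that $t>0$ is on the exterior side. Put $\Pi(\pm s)=\{V_x(\pm s):x\in\mathbb P\}$ (equidistant surfaces), $\mathcal C_{ext}(s)=\{V_x(s):x\in\mathcal C\}$, $\mathcal C_{int}(s)=\{V_x(-s):x\in\mathcal C\}$, $N_{ext}(s)=\mathcal C_{ext}(s)/G$, $N_{int}(s)=\mathcal C_{int}(s)/G$. For an axis $Ax_W\subset\partial\mathcal C$ (boundary taken in $\mathbb P$), let $Eq_W(s)$ be the set of points at distance $s$ from $Ax_W$; the curves $Eq_W(s)\cap\Pi(\pm s)$, which are the orthogonal projections $\{V_x(\pm s):x\in Ax_W\}$ of $Ax_W$, divide $Eq_W(s)$ into two strips, exactly one of which is disjoint from $\mathcal C$; call that one $Rec_W(s)$. The boundary of $\mathcal C$ in $\mathbb P$ consists of the axes of $A,B,A^{-1}B$ and of all their conjugates, and $F_A(s),F_B(s),F_{A^{-1}B}(s)$ (the funnels) are the images in $H$ of $Rec_A(s),Rec_B(s),Rec_{A^{-1}B}(s)$. *)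

(* Defs.v *)
From HB Require Import structures.
From mathcomp Require Import all_boot all_order all_algebra.
From mathcomp Require Import complex.
From mathcomp Require Import all_classical all_reals all_analysis.

Set Implicit Arguments.
Unset Strict Implicit.
Unset Printing Implicit Defensive.

Import Order.TTheory GRing.Theory Num.Theory.
Import numFieldNormedType.Exports.
Local Open Scope classical_set_scope.
Local Open Scope ring_scope.

Section UpperHalfSpace.
Variable R : realType.
Local Notation C := R[i].

Definition normsq (z : C) : R := complex.Re z ^+ 2 + complex.Im z ^+ 2.

Definition H3 := {p : C * R | 0 < p.2}.

Definition base (p : H3) : C := (val p).1.
Definition height (p : H3) : R := (val p).2.

(* The topology of H3 is the one induced by this embedding in R^3. *)
Definition coord (p : H3) : R * R * R :=
  (complex.Re (base p), complex.Im (base p), height p).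

Definition arcosh (x : R) : R := ln (x + Num.sqrt (x ^+ 2 - 1)).

Definition dist (p q : H3) : R :=
  arcosh (1 + (normsq (base p - base q) + (height p - height q) ^+ 2) /
              (2 * height p * height q)).

Definition dist_to (X : set H3) (p : H3) : R := inf (dist p @` X).

Definition same_component (X : set H3) (p q : H3) : Prop :=
  connected_component (coord @` X) (coord p) (coord q).

Definition geodesic (gamma : R -> H3) : Prop :=
  forall u v, dist (gamma u) (gamma v) = `|u - v|.

Definition line (M : set H3) : Prop :=
  exists2 gamma, geodesic gamma & M = range gamma.

Definition convex (K : set H3) : Prop :=
  forall gamma a b c, geodesic gamma -> a <= c <= b ->
    K (gamma a) -> K (gamma b) -> K (gamma c).

Definition velocity (gamma : R -> H3) (u : R) (v : R * R * R) : Prop :=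
  [/\ is_derive u 1 (fun t => (coord (gamma t)).1.1) v.1.1,
      is_derive u 1 (fun t => (coord (gamma t)).1.2) v.1.2 &
      is_derive u 1 (fun t => (coord (gamma t)).2) v.2].

Definition dot (v w : R * R * R) : R :=
  v.1.1 * w.1.1 + v.1.2 * w.1.2 + v.2 * w.2.

(* The hyperbolic metric is conformal to the Euclidean one, so hyperbolic
   right angles are Euclidean right angles between tangent vectors. *)
Definition orthogonal_at0 (gamma delta : R -> H3) : Prop :=
  gamma 0 = delta 0 /\
  exists v w, [/\ velocity gamma 0 v, velocity delta 0 w & dot v w = 0].

Definition orthogonal_lines (M N : set H3) : Prop :=
  exists gamma delta, [/\ geodesic gamma, geodesic delta, M = range gamma,
    N = range delta & orthogonal_at0 gamma delta].

Definition SL2 := {M : 'M[C]_2 | \det M == 1}.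

(* [option C] is the Riemann sphere, [None] being the point at infinity. *)
Definition mob (M : SL2) (zeta : option C) : option C :=
  let: (a, b, c, d) := (val M 0 0, val M 0 1, val M 1 0, val M 1 1) in
  match zeta with
  | Some z => if c * z + d == 0 then None else Some ((a * z + b) / (c * z + d))
  | None => if c == 0 then None else Some (a / c)
  end.

Definition poincare_denom (M : SL2) (p : H3) : R :=
  normsq (val M 1 0 * base p + val M 1 1) + normsq (val M 1 0) * height p ^+ 2.

Definition poincare_val (M : SL2) (p : H3) : C * R :=
  let: (a, b, c, d) := (val M 0 0, val M 0 1, val M 1 0, val M 1 1) in
  let: (z, t, D) := (base p, height p, poincare_denom M p) in
  (((a * z + b) * (c * z + d)^* + a * c^* * (t ^+ 2)%:C%C) / D%:C%C, t / D).

Lemma normsq_ge0 (z : C) : 0 <= normsq z.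
Proof. by rewrite addr_ge0 ?sqr_ge0. Qed.

Lemma normsq_eq0 (z : C) : normsq z = 0 -> z = 0.
Proof.
case: z => x y /eqP; rewrite /normsq /= paddr_eq0 ?sqr_ge0 // !sqrf_eq0.
by case/andP=> /eqP-> /eqP->.
Qed.

Lemma poincare_denom_gt0 (M : SL2) (p : H3) : 0 < poincare_denom M p.
Proof.
have t0 : 0 < height p := valP p.
have n1 := normsq_ge0 (val M 1 0 * base p + val M 1 1).
have n2 : 0 <= normsq (val M 1 0) * height p ^+ 2.
  by rewrite mulr_ge0 ?normsq_ge0 ?sqr_ge0.
rewrite lt_def (addr_ge0 n1 n2) andbT.
apply/negP; rewrite paddr_eq0 //.
rewrite mulf_eq0 sqrf_eq0 (gt_eqF t0) orbF.
case/andP=> /eqP/normsq_eq0 + /eqP/normsq_eq0 c0.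
rewrite c0 mul0r add0r => d0; have := valP M.
rewrite (expand_det_row _ 1) big1 ?[0 == 1]eq_sym ?oner_eq0 // => i _.
have [->|->] : i = 0 \/ i = 1 by case: i => [[|[|]]] // ?; [left|right]; apply: val_inj.
  by rewrite c0 mul0r.
by rewrite d0 mul0r.
Qed.

Lemma poincare_subproof (M : SL2) (p : H3) : 0 < (poincare_val M p).2.
Proof. by rewrite divr_gt0 ?poincare_denom_gt0 //; exact: (valP p). Qed.

(* Poincare extension to H3 of the action on the Riemann sphere. *)
Definition poincare (M : SL2) (p : H3) : H3 :=
  exist _ (poincare_val M p) (poincare_subproof M p).

Definition mobius (g : H3 -> H3) : Prop := exists M, g = poincare M.

Definition inv (g : H3 -> H3) : H3 -> H3 := fun p => xget p [set q | g q = p].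

Definition parabolic (M : SL2) : Prop :=
  exists! zeta : option C, mob M zeta = zeta.

(* The line along which [W] acts as a nontrivial translation; it is empty when
   [W] is not loxodromic. *)
Definition axis (W : H3 -> H3) : set H3 :=
  [set p | exists gamma l, [/\ geodesic gamma, 0 < l,
     forall t, W (gamma t) = gamma (t + l) & range gamma p]].

Definition half_turn (M : set H3) (h : H3 -> H3) : Prop :=
  [/\ mobius h, h <> id, h \o h = id & forall p, M p -> h p = p].

(* The letter (k, e) is the k-th generator, inverted when e is true. *)
Fixpoint word (a b : H3 -> H3) (w : seq (bool * bool)) : H3 -> H3 :=
  if w is (k, e) :: w' then
    let x := if k then b else a in
    (if e then inv x else x) \o word a b w'
  else id.

Definition reduced (w : seq (bool * bool)) : bool :=
  sorted (fun l m => ~~ ((l.1 == m.1) && (l.2 != m.2))) w.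

Definition generators (G : set (H3 -> H3)) (a b : H3 -> H3) : Prop :=
  [/\ mobius a, mobius b & G = range (word a b)].

Definition free_rank2 (G : set (H3 -> H3)) : Prop :=
  exists a b, generators G a b /\
    forall w, reduced w -> w != [::] -> word a b w <> id.

Definition discrete (G : set (H3 -> H3)) : Prop :=
  forall M : SL2, G (poincare M) -> exists2 e : R, 0 < e &
    forall N : SL2, G (poincare N) ->
      (forall i k, normsq (val N i k - val M i k) < e) -> N = M.

Definition Delta : set (option C) :=
  [set zeta | exists2 z, zeta = Some z & normsq z < 1].

Definition fuchsian (G : set (H3 -> H3)) : Prop :=
  discrete G /\
  forall g, G g -> exists2 M, g = poincare M & mob M @` Delta = Delta.

Definition no_parabolic (G : set (H3 -> H3)) : Prop :=
  forall M, G (poincare M) -> ~ parabolic M.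

Definition orbit (G : set (H3 -> H3)) (p : H3) : set H3 := [set g p | g in G].

Definition quotient (G : set (H3 -> H3)) :=
  {O : set H3 | exists p, O = orbit G p}.

Definition proj (G : set (H3 -> H3)) (p : H3) : quotient G :=
  exist _ (orbit G p) (ex_intro _ p erefl).

Definition plane : set H3 := [set p | normsq (base p) + height p ^+ 2 = 1].

Definition exterior : set H3 := [set p | 1 < normsq (base p) + height p ^+ 2].

(* gamma is the parameterized normal V_x. *)
Definition normal (x : H3) (gamma : R -> H3) : Prop :=
  [/\ geodesic gamma, gamma 0 = x,
      forall delta, geodesic delta -> delta 0 = x -> range delta `<=` plane ->
        orthogonal_at0 gamma delta &
      forall t, 0 < t -> exterior (gamma t)].

Definition push (X : set H3) (s : R) : set H3 :=
  [set q | exists x gamma, [/\ X x, normal x gamma & q = gamma s]].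

Definition near_boundary (zeta : option C) (e : R) : set H3 :=
  [set p | match zeta with
           | Some w => normsq (base p - w) + height p ^+ 2 < e ^+ 2
           | None => e ^- 2 < normsq (base p) + height p ^+ 2
           end].

Definition limit_set (G : set (H3 -> H3)) : set (option C) :=
  [set zeta | exists p, forall e, 0 < e ->
     exists2 q, orbit G p q & near_boundary zeta e q].

Definition joins (gamma : R -> H3) (zeta xi : option C) : Prop :=
  forall e, 0 < e -> (\forall t \near -oo, near_boundary zeta e (gamma t)) /\
                     (\forall t \near +oo, near_boundary xi e (gamma t)).

Definition convex_hull (X : set (option C)) : set H3 :=
  [set p | forall K, convex K ->
     (forall gamma zeta xi, X zeta -> X xi -> geodesic gamma ->
        joins gamma zeta xi -> range gamma `<=` K) -> K p].

Definition core (G : set (H3 -> H3)) : set H3 := convex_hull (limit_set G).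

Definition Eq (W : H3 -> H3) (s : R) : set H3 :=
  [set p | dist_to (axis W) p = s].

Definition Eq_cut (W : H3 -> H3) (s : R) : set H3 :=
  Eq W s `\` (push plane s `|` push plane (- s)).

Definition strip (W : H3 -> H3) (s : R) (X : set H3) : Prop :=
  exists2 p, Eq_cut W s p & X = same_component (Eq_cut W s) p.

(* The strip disjoint from the core (for a boundary axis of the core there is
   exactly one), taken without its edges. The edges are pushes of the axis,
   hence are contained in [push (core G) s] and [push (core G) (- s)]. *)
Definition Rec (G : set (H3 -> H3)) (W : H3 -> H3) (s : R) : set H3 :=
  [set p | exists X, [/\ strip W s X, X `&` core G = set0 & X p]].

Definition N_ext (G : set (H3 -> H3)) (s : R) : set (quotient G) :=
  proj G @` push (core G) s.

Definition N_int (G : set (H3 -> H3)) (s : R) : set (quotient G) :=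
  proj G @` push (core G) (- s).

Definition funnel (G : set (H3 -> H3)) (W : H3 -> H3) (s : R) :
  set (quotient G) := proj G @` Rec G W s.

Arguments N_ext : clear implicits.
Arguments N_int : clear implicits.
Arguments funnel : clear implicits.

Definition surface (G : set (H3 -> H3)) (A B : H3 -> H3) (s : R) :
    set (quotient G) :=
  N_ext G s `|` N_int G s `|` funnel G A s `|` funnel G B s
  `|` funnel G (inv A \o B) s.

Definition separates (M N1 N2 : set H3) : Prop :=
  [/\ N1 `<=` plane `\` M, N2 `<=` plane `\` M &
      forall p q, N1 p -> N2 q -> ~ same_component (plane `\` M) p q].

Definition stopping_lines (L LA LB : set H3) : Prop :=
  [/\ ~ separates L LA LB, ~ separates LA L LB & ~ separates LB L LA].

Definition stopping (G : set (H3 -> H3)) (A B : H3 -> H3)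
    (L LA LB : set H3) (HL HLA HLB : H3 -> H3) : Prop :=
  [/\ generators G A B /\ axis A `&` axis B = set0,
      [/\ line L, line LA & line LB] /\
      [/\ L `<=` plane, LA `<=` plane & LB `<=` plane],
      orthogonal_lines L (axis A) /\ orthogonal_lines L (axis B),
      [/\ half_turn L HL, half_turn LA HLA & half_turn LB HLB] /\
      (A = HL \o HLA /\ B = HL \o HLB) &
      stopping_lines L LA LB].

Definition induces (G : set (H3 -> H3)) (h : H3 -> H3)
    (j : quotient G -> quotient G) : Prop :=
  forall p, j (proj G p) = proj G (h p).

Definition hyperelliptic (G : set (H3 -> H3)) (HL HLA HLB : H3 -> H3)
    (j : quotient G -> quotient G) : Prop :=
  [/\ induces HL j, induces HLA j & induces HLB j].

End UpperHalfSpace.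

Arguments N_ext {R} G s.
Arguments N_int {R} G s.
Arguments funnel {R} G W s.
Arguments surface {R} G A B s.

(* Main.v *)
Require Import Defs.
From mathcomp Require Import all_boot all_order all_algebra.
From mathcomp Require Import complex ring lra.
From mathcomp Require Import all_classical all_reals all_analysis.
Import Defs.
Set Implicit Arguments.
Unset Strict Implicit.
Unset Printing Implicit Defensive.
Import Order.TTheory GRing.Theory Num.Theory.
Import numFieldNormedType.Exports.
Local Open Scope classical_set_scope.
Local Open Scope ring_scope.

(* H_L conjugates A and B to their inverses, H_{L_A} does so to
   A^{-1}B = H_{L_A} H_{L_B}, and both carry G-orbits to G-orbits. A half-turn
   about a line of the plane P, written in coordinates, is an inversion centred
   on the boundary followed by a Euclidean reflection, so it is a conformal
   isometry which preserves P and exchanges its two sides. It therefore preserves the core, turns the normal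
   V_x(t) into V_{h x}(-t), exchanges C_ext(s) with C_int(s), and preserves the
   axis of any element it inverts, together with the strip Rec attached to it.

   That the core lies in P is needed for the normals to be meaningful. In the
   hyperboloid model, points of a geodesic satisfy a three-term linear relation
   with hyperbolic sine coefficients. Applied to the linear function
   side p = (|p|^2 - 1) / height p, whose zero set is P and which half-turns
   change into its opposite, it shows that P is convex, that side is odd along a
   geodesic through P, and that a geodesic with both ends on the unit circle lies
   in P. The limit set lies on the unit circle as side is constant on orbits. *)

(** * Half-turns in coordinates *)

Section HalfTurns.
Variable R : realType.
Implicit Types (p q : H3 R) (L : set (H3 R)) (h : H3 R -> H3 R).

Lemma coord_inj : injective (@coord R).
Proof.
move=> p q; case: p => -[[x y] t] /= tp; case: q => -[[x' y'] t'] /= tq.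
by rewrite /coord /base /height /= => -[e1 e2 e3]; apply: val_inj; rewrite /= e1 e2 e3.
Qed.

Lemma coord_gt0 p : 0 < (coord p).2.
Proof. exact: (valP p). Qed.

Definition mkH3 (x y t : R) (t0 : 0 < t) : H3 R := exist _ ((x +i* y)%C, t) t0.

Lemma planeE p :
  plane p = ((coord p).1.1 ^+ 2 + (coord p).1.2 ^+ 2 + (coord p).2 ^+ 2 = 1).
Proof. by []. Qed.

Lemma exteriorE p :
  exterior p = (1 < (coord p).1.1 ^+ 2 + (coord p).1.2 ^+ 2 + (coord p).2 ^+ 2).
Proof. by []. Qed.

(** With z = x + iy, u1 + i u2 is cz + d and v1 + i v2 is az + b. Separating real and imaginary
    parts turns later claims into real polynomial identities. *)
Lemma poincare_coord (M : SL2 R) :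
  exists a1 a2 b1 b2 c1 c2 d1 d2 : R,
  [/\ a1 * d1 - a2 * d2 - (b1 * c1 - b2 * c2) = 1,
      a1 * d2 + a2 * d1 - (b1 * c2 + b2 * c1) = 0 &
  forall p x y t, coord p = (x, y, t) ->
    let u1 := c1 * x - c2 * y + d1 in let u2 := c1 * y + c2 * x + d2 in
    let v1 := a1 * x - a2 * y + b1 in let v2 := a1 * y + a2 * x + b2 in
    let D := u1 ^+ 2 + u2 ^+ 2 + (c1 ^+ 2 + c2 ^+ 2) * t ^+ 2 in
    0 < D /\
    coord (poincare M p) =
      ((v1 * u1 + v2 * u2 + (a1 * c1 + a2 * c2) * t ^+ 2) / D,
       (v2 * u1 - v1 * u2 + (a2 * c1 - a1 * c2) * t ^+ 2) / D, t / D)].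
Proof.
have : \det (val M) = 1 by apply/eqP; exact: (valP M).
rewrite (expand_det_row _ 0) !big_ord_recl big_ord0 /= /cofactor !det_mx11 /= !mxE /=.
have -> : lift 0 0 = 1 :> 'I_2 by apply: val_inj.
have -> : lift (1 : 'I_2) 0 = 0 :> 'I_2 by apply: val_inj.
have -> : bump 0 0 = 1%N by [].
have D0 := poincare_denom_gt0 M.
have : forall p, coord (poincare M p) =
  (complex.Re (poincare_val M p).1, complex.Im (poincare_val M p).1,
   (poincare_val M p).2) by [].
rewrite /poincare_val.
set f := poincare M; move: (f) D0 => {}f; rewrite /poincare_denom /base /height.
move: (sval M 0 0) (sval M 0 1) (sval M 1 0) (sval M 1 1).
move=> [a1 a2] [b1 b2] [c1 c2] [d1 d2] D0 E detM.
exists a1, a2, b1, b2, c1, c2, d1, d2; split.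
- by move: detM => /(congr1 (@complex.Re R)) /=; nra.
- by move: detM => /(congr1 (@complex.Im R)) /=; nra.
move=> p x' y' t' ep; move: (D0 p) (E p) ep; move: (f p) => q.
rewrite /coord /base /height; case: p => -[[x y] t] /= ? + + [<- <- <-] {x' y' t'}.
set D := normsq _ + _.
have -> : D = (c1 * x - c2 * y + d1) ^+ 2 + (c1 * y + c2 * x + d2) ^+ 2 +
    (c1 ^+ 2 + c2 ^+ 2) * t ^+ 2 by rewrite /D /normsq /=; ring.
move=> {}D0 ->; split=> //=.
by congr (_, _, _); field; rewrite gt_eqF.
Qed.

(* Inversion in the sphere of radius 1 / sqrt k centred at (u, v, 0), followed by
   the horizontal reflection [[c, s], [s, -c]] about the same centre. *)
Definition turn (k u v c s : R) (x : R * R * R) : R * R * R :=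
  let r := k * ((x.1.1 - u) ^+ 2 + (x.1.2 - v) ^+ 2 + x.2 ^+ 2) in
  (u + (c * (x.1.1 - u) + s * (x.1.2 - v)) / r,
   v + (s * (x.1.1 - u) - c * (x.1.2 - v)) / r, x.2 / r).

(* The conditions under which [turn] exchanges the inside and the outside of the
   unit sphere. *)
Definition turn_data (k u v c s : R) : Prop :=
  [/\ 0 < k, k * (1 - u ^+ 2 - v ^+ 2) = 1, c ^+ 2 + s ^+ 2 = 1,
      c * u + s * v = - u & s * u - c * v = - v].

Definition plane_turn h : Prop := exists k u v c s,
  turn_data k u v c s /\ forall p, coord (h p) = turn k u v c s (coord p).

(** A point of the unit sphere corresponds to the Hermitian matrix P with rows (1, z) and (conj z,
    1). Fixing it means M P M' = P, where M' is the conjugate transpose. As det M = 1, the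
    equivalent equation M P = P M'^-1 is real-linear in the entries of M, and its second column
    gives the three relations. *)
Lemma fixed_point_coefs (a1 a2 b1 b2 c1 c2 d1 d2 x y t : R) :
  let u1 := c1 * x - c2 * y + d1 in let u2 := c1 * y + c2 * x + d2 in
  let v1 := a1 * x - a2 * y + b1 in let v2 := a1 * y + a2 * x + b2 in
  a1 * d1 - a2 * d2 - (b1 * c1 - b2 * c2) = 1 ->
  a1 * d2 + a2 * d1 - (b1 * c2 + b2 * c1) = 0 ->
  x ^+ 2 + y ^+ 2 + t ^+ 2 = 1 ->
  u1 ^+ 2 + u2 ^+ 2 + (c1 ^+ 2 + c2 ^+ 2) * t ^+ 2 = 1 ->
  v1 * u1 + v2 * u2 + (a1 * c1 + a2 * c2) * t ^+ 2 = x ->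
  v2 * u1 - v1 * u2 + (a2 * c1 - a1 * c2) * t ^+ 2 = y ->
  [/\ b1 + c1 = 2 * a2 * y, c2 - b2 = 2 * a2 * x & d2 = - a2].
Proof.
move=> u1 u2 v1 v2 H1 H2 n1 D1 ex ey.
(* The remaining diagonal entry of M P M', found from its determinant. *)
have ez : v1 ^+ 2 + v2 ^+ 2 + (a1 ^+ 2 + a2 ^+ 2) * t ^+ 2 = 1.
  set N := LHS.
  have : N * 1 = (x ^+ 2 + y ^+ 2) + (1 ^+ 2 + 0 ^+ 2) * t ^+ 2.
    by rewrite -{1}D1 -{1}ex -{1}ey -{1}H1 -{1}H2 /N /u1 /u2 /v1 /v2; ring.
  by rewrite mulr1 expr1n expr0n /= addr0 mul1r n1.
have ev1 : v1 = a1 * x + a2 * y - c1.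
  apply/eqP; rewrite -subr_eq0.
  (* The factors 1 and 0 are placeholders into which the hypotheses are rewritten backwards, leaving
     an identity for [ring]. *)
  have -> : v1 - (a1 * x + a2 * y - c1) =
    v1 * 1 + v2 * 0 - (a1 * x + a2 * y - c1 * 1) by ring.
  by rewrite -{1}H1 -{1}H2 -{1}ex -{1}ey -{1}ez /u1 /u2 /v1 /v2; apply/eqP; ring.
have ev2 : v2 = a1 * y - a2 * x + c2.
  apply/eqP; rewrite -subr_eq0.
  have -> : v2 - (a1 * y - a2 * x + c2) =
    v2 * 1 - v1 * 0 - (a1 * y - a2 * x + c2 * 1) by ring.
  by rewrite -{1}H1 -{1}H2 -{1}ex -{1}ey -{1}ez /u1 /u2 /v1 /v2; apply/eqP; ring.
have eu2 : u2 = - a2 + (c1 * y + c2 * x).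
  apply/eqP; rewrite -subr_eq0.
  have -> : u2 - (- a2 + (c1 * y + c2 * x)) =
    u2 * 1 - u1 * 0 - (- a2 * 1 + (c1 * y + c2 * x)) by ring.
  by rewrite -{1}H1 -{1}H2 -{1}D1 -{1}ey -{1}ex /u1 /u2 /v1 /v2; apply/eqP; ring.
by move: ev1 ev2 eu2; rewrite /v1 /v2 /u2; split; lra.
Qed.

(** Comparing the relations of [fixed_point_coefs] at two distinct fixed points makes [a2] vanish;
    being an involution other than the identity then makes the trace vanish, which leaves the matrix
    of a [turn]. *)
Lemma half_turn_plane_turn L h p q : half_turn L h -> L p -> L q -> p <> q ->
  plane p -> plane q -> plane_turn h.
Proof.
case=> -[M ->] neq_id hh fixL Lp Lq npq Pp Pq.
have [a1 [a2 [b1 [b2 [c1 [c2 [d1 [d2 [H1 H2 cM]]]]]]]]] := poincare_coord M.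
move: (poincare M) neq_id hh fixL cM => g neq_id gg fixL cM.
have coefs w : L w -> plane w ->
    [/\ b1 + c1 = 2 * a2 * (coord w).1.2, c2 - b2 = 2 * a2 * (coord w).1.1
      & d2 = - a2].
  move=> /fixL ew; rewrite planeE; move: (coord_gt0 w) (cM w).
  rewrite ew; case: (coord w) => -[x y] t /= t0 /(_ _ _ _ erefl) [D0 [+ + et]] n1.
  have D1 : (c1 * x - c2 * y + d1) ^+ 2 + (c1 * y + c2 * x + d2) ^+ 2 +
      (c1 ^+ 2 + c2 ^+ 2) * t ^+ 2 = 1.
    move: et D0; set D := _ + _ => et D0.
    apply: (mulfI (lt0r_neq0 t0)); rewrite mulr1 {1}et divfK //.
    exact: lt0r_neq0.
  rewrite D1 !divr1 => ex ey.
  exact: fixed_point_coefs H1 H2 n1 D1 (esym ex) (esym ey).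
have [ex ey ed] := coefs _ Lp Pp; have [ex' ey' _] := coefs _ Lq Pq.
(* Otherwise the relations determine x and y, and the unit sphere determines the positive height, so
   p = q. *)
have a20 : a2 = 0.
  apply/eqP/negP => /negP a2n0; apply: npq; apply: coord_inj.
  move: Pp Pq (coord_gt0 p) (coord_gt0 q) ex ey ex' ey'; rewrite !planeE.
  case: (coord p) => -[x y] t; case: (coord q) => -[x' y'] t' /=.
  move=> n1 n1' t0 t0' e1 e2 e1' e2'.
  have two_a : 2 * a2 != 0 by rewrite mulf_neq0 // pnatr_eq0.
  have exx : x = x' by apply: (mulfI two_a); rewrite -e2 -e2'.
  have eyy : y = y' by apply: (mulfI two_a); rewrite -e1 -e1'.
  subst x' y'; congr (_, _, _); apply/eqP.
  by rewrite -(eqrXn2 (n := 2)) ?ltW //; apply/eqP; lra.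
have d20 : d2 = 0 by rewrite ed a20 oppr0.
have eb1 : b1 = - c1 by move: ex; rewrite a20; lra.
have eb2 : b2 = c2 by move: ey; rewrite a20; lra.
subst a2 d2 b1 b2; clear ex ey ex' ey'.
set be := c1 ^+ 2 + c2 ^+ 2.
have detE : a1 * d1 + be = 1 by rewrite /be; lra.
have {}cM w x y t : coord w = (x, y, t) ->
    let u1 := c1 * x - c2 * y + d1 in let u2 := c1 * y + c2 * x in
    let v1 := a1 * x - c1 in let v2 := a1 * y + c2 in
    let D := u1 ^+ 2 + u2 ^+ 2 + be * t ^+ 2 in
    0 < D /\ coord (g w) = ((v1 * u1 + v2 * u2 + a1 * c1 * t ^+ 2) / D,
                            (v2 * u1 - v1 * u2 - a1 * c2 * t ^+ 2) / D, t / D).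
  by move/cM; rewrite !(mul0r, subr0, addr0, add0r, oppr0, mulNr).
(* Being an involution, g restores the height of (0, 0, t) for every t, which
   forces the trace a1 + d1 to vanish. *)
have key (t : R) : 0 < t ->
    (d1 * (d1 ^+ 2 - be) + be * (a1 + d1) * t ^+ 2) ^+ 2 = d1 ^+ 2.
  move=> t0; pose w := mkH3 0 0 t0.
  have := congr1 (fun f => (coord (f w)).2) gg; rewrite [_ (id w)]/=.
  have [D0 /cM [D'0 ->]] := cM w _ _ _ erefl; move: D0 D'0.
  rewrite /= !(mulr0, subr0, add0r, addr0, expr0n, oppr0) /= -[height w]/t.
  set D := d1 ^+ 2 + _; set D' := _ ^+ 2 + _ ^+ 2 + _ => D0 D'0 et.
  have DD' : D * D' = 1.
    apply: (mulfI (lt0r_neq0 t0)); rewrite mulr1 -{1}et.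
    by field; rewrite !lt0r_neq0.
  apply/eqP; rewrite -subr_eq0.
  have -> : (d1 * (d1 ^+ 2 - be) + be * (a1 + d1) * t ^+ 2) ^+ 2 - d1 ^+ 2 =
     D * (D * D') - D.
    by move: D0; rewrite /D' /D /be => D0; field; rewrite lt0r_neq0.
  by rewrite DD' mulr1 subrr.
have trace0 : be * (a1 + d1) = 0.
  (* Equality of the squares (P + Q t^2)^2 at t = 1, 2, 3 forces Q = 0. *)
  have := key _ (ltr0n R 1); have := key _ (ltr0n R 2); have := key _ (ltr0n R 3).
  move: (d1 * _) (be * _) => P Q k1 k2 k3.
  by apply/eqP; rewrite -sqrf_eq0; apply/eqP; nra.
have [be0|be_n0] := eqVneq be 0.
  (* Here the matrix is real and diagonal, and [key] gives d1^6 = d1^2, so it is plus or minus the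
     identity. *)
  case: neq_id; apply/funext => w; apply: coord_inj.
  move: be0 => /eqP; rewrite /be paddr_eq0 ?sqr_ge0 // !sqrf_eq0.
  move=> /andP[/eqP c10 /eqP c20].
  have := key _ (ltr0n R 1); have := coord_gt0 w.
  case ew : (coord w) => [[x y] t] /= t0; move: (cM _ _ _ _ ew) detE.
  rewrite /be c10 c20 /= !(mul0r, mulr0, oppr0, subr0, add0r, addr0, expr0n) /=.
  case=> D0 -> ad1 dE.
  have d1n0 : d1 != 0 by apply/eqP => d10; move: ad1; rewrite d10; lra.
  have d4 : (d1 ^+ 2) ^+ 2 = 1.
    by apply: (mulfI (expf_neq0 2 d1n0)); rewrite mulr1 -[RHS]dE; ring.
  have d2 : d1 ^+ 2 = 1.
    by apply/eqP; rewrite -(eqrXn2 (n := 2)) ?sqr_ge0 // d4 expr1n.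
  have ea : a1 = d1 by apply: (mulIf d1n0); rewrite ad1 -expr2 d2.
  by rewrite d2 ea !divr1; congr (_, _, _); rewrite mulrAC -expr2 d2 mul1r.
have ed : d1 = - a1.
  by apply/eqP; rewrite -addr_eq0 addrC; move/eqP: trace0; rewrite mulf_eq0 (negPf be_n0).
have be_gt0 : 0 < be by rewrite lt_def be_n0 addr_ge0 ?sqr_ge0.
have beE : be = 1 + a1 ^+ 2 by rewrite -detE ed; ring.
(* With trace zero, Mz = a/c - 1 / (c^2 (z - a/c)). So k = |c|^2, the centre is a/c, and the
   reflection is w -> - (conj c)^2 / |c|^2 conj w. *)
exists be, (a1 * c1 / be), (- (a1 * c2) / be), ((c2 ^+ 2 - c1 ^+ 2) / be),
  (2 * c1 * c2 / be); split.
  split=> //; first 1 last.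
  - by rewrite /be; field.
  - by rewrite /be; field.
  - by rewrite /be; field.
  transitivity (be - a1 ^+ 2 * (c1 ^+ 2 + c2 ^+ 2) / be); first by field.
  by rewrite -/be mulfK // beE; ring.
move=> w; case ew : (coord w) => [[x y] t]; have [] := cM _ _ _ _ ew.
rewrite ed /turn /=.
set D := _ + be * t ^+ 2 => D0 ->.
have -> : be * ((x - a1 * c1 / be) ^+ 2 + (y - (- (a1 * c2) / be)) ^+ 2 + t ^+ 2) = D.
  by rewrite /D /be; field.
have Dn0 := lt0r_neq0 D0.
have one : be - a1 ^+ 2 = 1 by rewrite beE; ring.
congr (_, _, _).
- apply: (mulIf Dn0); rewrite [RHS]mulrDl !(mulfVK Dn0).
  by rewrite -[X in _ = _ + X]mulr1 -[X in _ = _ + _ * X]one /D /be; field.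
- apply: (mulIf Dn0); rewrite [RHS]mulrDl !(mulfVK Dn0).
  by rewrite -[X in _ = _ + X]mulr1 -[X in _ = _ + _ * X]one /D /be; field.
Qed.

End HalfTurns.

(** * Euclidean behaviour of turns: distances, tangent vectors, continuity *)

Section Turns.
Variable R : realType.
Implicit Types (p q : H3 R) (h : H3 R -> H3 R) (x v w : R * R * R).

Lemma is_derive_add (F G : R -> R) (u dF dG : R) : is_derive u 1 F dF ->
  is_derive u 1 G dG -> is_derive u 1 (fun t => F t + G t) (dF + dG).
Proof. exact: is_deriveD. Qed.

Lemma is_derive_scale (F : R -> R) (u m dF : R) : is_derive u 1 F dF ->
  is_derive u 1 (fun t => m * F t) (m * dF).
Proof. exact: is_deriveZ. Qed.

Lemma is_derive_subc (F : R -> R) (u m dF : R) : is_derive u 1 F dF ->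
  is_derive u 1 (fun t => F t - m) dF.
Proof.
move=> dFu; apply: is_derive_eq (is_derive_add dFu (is_derive_cst (- m) u 1)) _.
by rewrite addr0.
Qed.

Lemma is_derive_mul (F G : R -> R) (u dF dG : R) : is_derive u 1 F dF ->
  is_derive u 1 G dG -> is_derive u 1 (fun t => F t * G t) (F u * dG + G u * dF).
Proof. exact: is_deriveM. Qed.

Lemma is_derive_div (F G : R -> R) (u dF dG : R) : G u != 0 ->
  is_derive u 1 F dF -> is_derive u 1 G dG ->
  is_derive u 1 (fun t => F t / G t) ((dF * G u - F u * dG) / G u ^+ 2).
Proof.
move=> G0 dFu dGu; apply: is_derive_eq (is_derive_mul dFu (is_deriveV G0 dGu)) _.
by rewrite /GRing.scale /=; field.
Qed.

Definition norm3 x : R := dot x x.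

Lemma norm3E x : norm3 x = x.1.1 ^+ 2 + x.1.2 ^+ 2 + x.2 ^+ 2.
Proof. by rewrite /norm3 /dot !expr2. Qed.

Lemma norm3_ge0 x : 0 <= norm3 x.
Proof. by rewrite norm3E !addr_ge0 ?sqr_ge0. Qed.

Lemma distE p q : dist p q = arcosh (1 + norm3 (coord p - coord q) /
  (2 * (coord p).2 * (coord q).2)).
Proof.
rewrite norm3E /dist /normsq /coord /base /height.
by case: p => -[[? ?] ?] /= ?; case: q => -[[? ?] ?].
Qed.

Variables (k a b c s : R).
Hypothesis data : turn_data k a b c s.
Let f := turn k a b c s.
Let centre : R * R * R := (a, b, 0).
Let radius x := k * norm3 (x - centre).

Lemma radius_gt0 x : x != centre -> 0 < radius x.
Proof.
case: data => k0 _ _ _ _ nx; rewrite mulr_gt0 // lt_def norm3_ge0 andbT.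
apply: contra nx; rewrite norm3E /=.
case: x => -[x y] t /=; rewrite !paddr_eq0 ?sqr_ge0 ?addr_ge0 ?sqr_ge0 // !sqrf_eq0.
by rewrite !subr_eq0 => /andP[/andP[/eqP-> /eqP->] /eqP->].
Qed.

Lemma turnE x : f x =
  (a + (c * (x.1.1 - a) + s * (x.1.2 - b)) / radius x,
   b + (s * (x.1.1 - a) - c * (x.1.2 - b)) / radius x, x.2 / radius x).
Proof. by rewrite /radius norm3E /f /turn /= subr0. Qed.

Lemma turn_height x : (f x).2 = x.2 / radius x.
Proof. by rewrite turnE. Qed.

Lemma turn_norm3B x y : x != centre -> y != centre ->
  norm3 (f x - f y) = norm3 (x - y) / (radius x * radius y).
Proof.
move=> /radius_gt0/lt0r_neq0 + /radius_gt0/lt0r_neq0.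
rewrite !turnE; case: data => k0 _ cs _ _.
have ex : radius x = k * norm3 (x - centre) by [].
have ey : radius y = k * norm3 (y - centre) by [].
move: ex ey; move: (radius x) (radius y) => r r'; rewrite !norm3E /=.
case: x => -[x1 x2] x3; case: y => -[y1 y2] y3 /=; rewrite !subr0 => er er' r0 r0'.
have -> : a + (c * (x1 - a) + s * (x2 - b)) / r -
  (a + (c * (y1 - a) + s * (y2 - b)) / r') =
  c * ((x1 - a) / r - (y1 - a) / r') + s * ((x2 - b) / r - (y2 - b) / r') by field; rewrite ?r0 ?r0'.
have -> : b + (s * (x1 - a) - c * (x2 - b)) / r -
  (b + (s * (y1 - a) - c * (y2 - b)) / r') =
  s * ((x1 - a) / r - (y1 - a) / r') - c * ((x2 - b) / r - (y2 - b) / r') by field; rewrite ?r0 ?r0'.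
transitivity ((c ^+ 2 + s ^+ 2) * (((x1 - a) / r - (y1 - a) / r') ^+ 2 +
  ((x2 - b) / r - (y2 - b) / r') ^+ 2) + (x3 / r - y3 / r') ^+ 2); first by ring.
rewrite cs mul1r.
have kn0 := lt0r_neq0 k0.
transitivity (((x1 - a) ^+ 2 + (x2 - b) ^+ 2 + x3 ^+ 2) / r ^+ 2 +
  ((y1 - a) ^+ 2 + (y2 - b) ^+ 2 + y3 ^+ 2) / r' ^+ 2 -
  2 * ((x1 - a) * (y1 - a) + (x2 - b) * (y2 - b) + x3 * y3) / (r * r')).
  by field; rewrite ?r0 ?r0'.
(* For X and Y the positions relative to the centre, |X|^2 / r and |Y|^2 / r' both equal 1/k, so the
   two square terms exchange numerators. *)
have -> : ((x1 - a) ^+ 2 + (x2 - b) ^+ 2 + x3 ^+ 2) / r ^+ 2 =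
  ((y1 - a) ^+ 2 + (y2 - b) ^+ 2 + y3 ^+ 2) / (r * r').
  rewrite -[X in X / _](mulKf kn0) -er -[X in _ = X / _](mulKf kn0) -er'.
  by field; rewrite ?r0 ?r0'.
have -> : ((y1 - a) ^+ 2 + (y2 - b) ^+ 2 + y3 ^+ 2) / r' ^+ 2 =
  ((x1 - a) ^+ 2 + (x2 - b) ^+ 2 + x3 ^+ 2) / (r * r').
  rewrite -[X in X / _](mulKf kn0) -er' -[X in _ = X / _](mulKf kn0) -er.
  by field; rewrite ?r0 ?r0'.
by field; rewrite ?r0 ?r0'.
Qed.

(** The centre has power -1/k with respect to the unit sphere, so inversion followed by central
    symmetry about the centre preserves the sphere and swaps its sides. By the last two conditions
    of [turn_data], [turn] differs from this by an orthogonal map fixing the centre. *)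
Lemma turn_norm3 x : x != centre -> norm3 (f x) - 1 = - ((norm3 x - 1) / radius x).
Proof.
move=> /radius_gt0/lt0r_neq0.
case: data => k0 ck cs e1 e2; have kn0 := lt0r_neq0 k0.
have er : radius x = k * norm3 (x - centre) by [].
rewrite turnE; move: er; move: (radius x) => r; rewrite !norm3E /=.
case: x => -[x y] t /=; rewrite subr0 => er r0.
have q0 : 1 - a ^+ 2 - b ^+ 2 = k^-1 by rewrite -[LHS](mulKf kn0) ck mulr1.
have rE : (x - a) ^+ 2 + (y - b) ^+ 2 + t ^+ 2 = r / k by rewrite er mulrC mulKf.
have n1 : x ^+ 2 + y ^+ 2 + t ^+ 2 - 1 = r / k + 2 * (a * (x - a) + b * (y - b)) - k^-1.
  by rewrite -rE -q0; ring.
rewrite n1.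
transitivity ((a ^+ 2 + b ^+ 2 - 1) + 2 * ((c * a + s * b) * (x - a) + (s * a - c * b) * (y - b)) / r
  + ((c ^+ 2 + s ^+ 2) * ((x - a) ^+ 2 + (y - b) ^+ 2) + t ^+ 2) / r ^+ 2).
  by field.
rewrite e1 e2 cs mul1r rE.
have -> : a ^+ 2 + b ^+ 2 - 1 = - k^-1 by rewrite -q0; ring.
by field; rewrite ?r0.
Qed.

(** The differential of [turn] at [x]: inversion reflects [v] in the plane orthogonal to [q] and
    divides by the radius factor; the horizontal reflection follows. *)
Definition dturn x v : R * R * R :=
  let q := x - centre in let e := 2 * dot q v / norm3 q in
  let y1 := v.1.1 - e * q.1.1 in let y2 := v.1.2 - e * q.1.2 in
  ((c * y1 + s * y2) / radius x, (s * y1 - c * y2) / radius x,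
   (v.2 - e * q.2) / radius x).

Lemma dot_dturn x v w : x != centre ->
  dot (dturn x v) (dturn x w) = dot v w / radius x ^+ 2.
Proof.
move=> /[dup] xn /radius_gt0/lt0r_neq0 r0.
have n0 : norm3 (x - centre) != 0.
  by apply: contra r0 => /eqP; rewrite /radius => ->; rewrite mulr0.
case: data => k0 _ cs _ _.
rewrite /dturn; move: r0 n0; move: (radius x) => r; rewrite /norm3.
move: (x - centre) v w => -[[q1 q2] q3] [[v1 v2] v3] [[w1 w2] w3]; rewrite /dot /= => r0 n0.
set n := q1 * q1 + _ + _; set e := 2 * (q1 * v1 + _ + _) / n.
set e' := 2 * (q1 * w1 + _ + _) / n.
transitivity (((c ^+ 2 + s ^+ 2) * ((v1 - e * q1) * (w1 - e' * q1) +
  (v2 - e * q2) * (w2 - e' * q2)) + (v3 - e * q3) * (w3 - e' * q3)) / r ^+ 2).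
  by field.
by rewrite cs mul1r /e /e' /n; field; rewrite r0.
Qed.

Lemma velocity_turn (gamma delta : R -> H3 R) v :
  coord (gamma 0) != centre -> (forall t, coord (delta t) = f (coord (gamma t))) ->
  velocity gamma 0 v -> velocity delta 0 (dturn (coord (gamma 0)) v).
Proof.
move=> /[dup] xn /radius_gt0/lt0r_neq0 r0 dE [d1 d2 d3].
have n0 : norm3 (coord (gamma 0) - centre) != 0.
  by apply: contra r0 => /eqP; rewrite /radius => ->; rewrite mulr0.
have k0 : k != 0 by case: data => /lt0r_neq0.
pose X t := (coord (gamma t)).1.1; pose Y t := (coord (gamma t)).1.2.
pose T t := (coord (gamma t)).2.
pose r t := k * ((X t - a) * (X t - a) + (Y t - b) * (Y t - b) + T t * T t).
have rE t : radius (coord (gamma t)) = r t.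
  by rewrite /radius norm3E /= subr0 /r -!expr2.
pose r' := 2 * k * dot (coord (gamma 0) - centre) v.
have dr : is_derive (0 : R) 1 r r'.
  have da := is_derive_subc a d1; have db := is_derive_subc b d2.
  apply: is_derive_eq (is_derive_scale k (is_derive_add
    (is_derive_add (is_derive_mul da da) (is_derive_mul db db)) (is_derive_mul d3 d3))) _.
  by rewrite /r' /dot /= subr0 /X /Y /T; ring.
have r00 : r 0 != 0 by rewrite -rE.
(* Both horizontal coordinates are instances, with [(m, n, z)] equal to [(c, s, a)] and
   [(s, - c, b)]. *)
have lin (m n z : R) : is_derive (0 : R) 1 (fun t => z + (m * (X t - a) + n * (Y t - b)) / r t)
    (((m * v.1.1 + n * v.1.2) * r 0 - (m * (X 0 - a) + n * (Y 0 - b)) * r') / r 0 ^+ 2).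
  have da := is_derive_subc a d1; have db := is_derive_subc b d2.
  have dN := is_derive_add (is_derive_scale m da) (is_derive_scale n db).
  by apply: is_derive_eq (is_derive_add (is_derive_cst z _ _)
    (is_derive_div r00 dN dr)) _; rewrite add0r.
have eE : 2 * dot (coord (gamma 0) - centre) v / norm3 (coord (gamma 0) - centre) = r' / r 0.
  by rewrite -rE /r' /radius; field; rewrite k0 n0.
have dxE t : coord (delta t) = (a + (c * (X t - a) + s * (Y t - b)) / r t,
    b + (s * (X t - a) - c * (Y t - b)) / r t, T t / r t).
  by rewrite dE turnE rE.
have qE : coord (gamma 0) - centre = (X 0 - a, Y 0 - b, T 0).
  by rewrite -[T 0]subr0.
rewrite /dturn eE rE qE; split.
- have -> : (fun t => (coord (delta t)).1.1) = (fun t => a + (c * (X t - a) + s * (Y t - b)) / r t).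
    by apply/funext => t; rewrite dxE.
  by apply: is_derive_eq (lin c s a) _; rewrite [RHS]/=; field.
- have -> : (fun t => (coord (delta t)).1.2) = (fun t => b + (s * (X t - a) + - c * (Y t - b)) / r t).
    by apply/funext => t; rewrite dxE mulNr.
  by apply: is_derive_eq (lin s (- c) b) _; rewrite [RHS]/=; field.
- have -> : (fun t => (coord (delta t)).2) = (fun t => T t / r t).
    by apply/funext => t; rewrite dxE.
  by apply: is_derive_eq (is_derive_div r00 d3 dr) _; rewrite [RHS]/=; field.
Qed.

Lemma turn_continuous x : x != centre -> {for x, continuous f}.
Proof.
move=> /radius_gt0/lt0r_neq0; rewrite /radius norm3E /= subr0 => r0.
pose c1 (y : R * R * R) := y.1.1; pose c2 (y : R * R * R) := y.1.2.
pose c3 (y : R * R * R) := y.2.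
have k1 : c1 y @[y --> x] --> c1 x.
  by apply: (@continuous_comp _ _ _ fst fst); exact: cvg_fst.
have k2 : c2 y @[y --> x] --> c2 x.
  by apply: (@continuous_comp _ _ _ fst snd); [exact: cvg_fst|exact: cvg_snd].
have k3 : c3 y @[y --> x] --> c3 x by exact: cvg_snd.
have ka : c1 y - a @[y --> x] --> c1 x - a by apply: cvgB k1 (cvg_cst a).
have kb : c2 y - b @[y --> x] --> c2 x - b by apply: cvgB k2 (cvg_cst b).
pose r y := k * ((c1 y - a) ^+ 2 + (c2 y - b) ^+ 2 + c3 y ^+ 2).
have kr : (r y)^-1 @[y --> x] --> (r x)^-1.
  apply: cvgV r0 _; apply: cvgM (cvg_cst k) _.
  by apply: cvgD (cvgM k3 k3); apply: cvgD (cvgM ka ka) (cvgM kb kb).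
have lin (m n z : R) :
    z + (m * (c1 y - a) + n * (c2 y - b)) / r y @[y --> x] -->
    z + (m * (c1 x - a) + n * (c2 x - b)) / r x.
  apply: cvgD (cvg_cst z) _; apply: cvgM _ kr.
  by apply: cvgD (cvgM (cvg_cst m) ka) (cvgM (cvg_cst n) kb).
have lin' := lin s (- c) b; rewrite mulNr in lin'.
have {}lin' : b + (s * (c1 y - a) - c * (c2 y - b)) / r y @[y --> x] -->
    b + (s * (c1 x - a) - c * (c2 x - b)) / r x.
  by move: lin'; under eq_fun do rewrite mulNr.
exact: (cvg_pair (cvg_pair (lin c s a) lin') (cvgM k3 kr)).
Qed.

End Turns.

(** * Geodesics in the hyperboloid model, the limit set and the core *)

Section Geodesics.
Variable R : realType.
Implicit Types (p q : H3 R) (gamma : R -> H3 R).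

Lemma arcosh_eq (x d : R) : 1 <= x -> arcosh x = d -> 2 * x = expR d + expR (- d).
Proof.
move=> x1; rewrite /arcosh; set y := Num.sqrt _ => <-.
have y2 : y ^+ 2 = x ^+ 2 - 1 by rewrite sqr_sqrtr // subr_ge0 exprn_ege1.
have xy0 : 0 < x + y by rewrite ltr_wpDr ?sqrtr_ge0 // (lt_le_trans ltr01).
rewrite expRN lnK ?posrE //.
have -> : (x + y)^-1 = x - y.
  by apply: (mulfI (lt0r_neq0 xy0)); rewrite divff ?lt0r_neq0 // [RHS]mulrC -subr_sqr y2; ring.
by ring.
Qed.

(* Twice the hyperbolic sine of the signed distance to the plane. *)
Definition side p : R := (norm3 (coord p) - 1) / (coord p).2.

Lemma planeP p : plane p <-> side p = 0.
Proof.
rewrite planeE -norm3E /side; split=> [->|/eqP]; first by rewrite subrr mul0r.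
by rewrite mulf_eq0 invr_eq0 (gt_eqF (coord_gt0 p)) orbF subr_eq0 => /eqP.
Qed.

Lemma exteriorP p : exterior p <-> 0 < side p.
Proof. by rewrite exteriorE -norm3E /side pmulr_lgt0 ?invr_gt0 ?coord_gt0 // subr_gt0. Qed.

(* For the Lorentzian form m s - x^2 - y^2 in light-cone coordinates, a null
   vector orthogonal to a timelike one vanishes. *)
Lemma null_orthogonal_timelike (M S X Y m s x y : R) : 0 < m -> 0 < s ->
  m * s = 1 + x ^+ 2 + y ^+ 2 -> M * S = X ^+ 2 + Y ^+ 2 ->
  M * s + S * m = 2 * (X * x + Y * y) -> M = 0 /\ S = 0.
Proof.
move=> m0 s0 ms MS orth.
(* Lagrange's identity writes the reversed Cauchy-Schwarz inequality as a vanishing sum of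
   squares. *)
have sum0 : (M * s - S * m) ^+ 2 + 4 * (X ^+ 2 + Y ^+ 2) + 4 * (X * y - Y * x) ^+ 2 = 0.
  transitivity ((M * s + S * m) ^+ 2 - 4 * (M * S) * (m * s) + 4 * (X ^+ 2 + Y ^+ 2)
    + 4 * (X * y - Y * x) ^+ 2); first by ring.
  by rewrite orth ms MS; ring.
have q1 := sqr_ge0 (M * s - S * m); have q2 := sqr_ge0 (X * y - Y * x).
have q3 := sqr_ge0 X; have q4 := sqr_ge0 Y.
have X0 : X = 0 by apply/eqP; rewrite -sqrf_eq0; apply/eqP; lra.
have Y0 : Y = 0 by apply/eqP; rewrite -sqrf_eq0; apply/eqP; lra.
have d0 : M * s - S * m = 0 by apply/eqP; rewrite -sqrf_eq0; apply/eqP; lra.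
rewrite X0 Y0 in orth; split; [apply: (mulIf (lt0r_neq0 s0))|apply: (mulIf (lt0r_neq0 m0))]; lra.
Qed.

(* G is twice the Gram matrix of the points in the hyperboloid model, where p has
   light-cone coordinates (|p|^2, 1, x, y) / height p. A combination orthogonal to
   all three points is null and orthogonal to p1, so it vanishes. *)
Lemma mink_sum p1 p2 p3 (a1 a2 a3 : R) :
  let G p q := 2 * (1 + norm3 (coord p - coord q) / (2 * (coord p).2 * (coord q).2)) in
  a1 * G p1 p1 + a2 * G p1 p2 + a3 * G p1 p3 = 0 ->
  a1 * G p2 p1 + a2 * G p2 p2 + a3 * G p2 p3 = 0 ->
  a1 * G p3 p1 + a2 * G p3 p2 + a3 * G p3 p3 = 0 ->
  a1 * side p1 + a2 * side p2 + a3 * side p3 = 0 /\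
  a1 / (coord p1).2 + a2 / (coord p2).2 + a3 / (coord p3).2 = 0.
Proof.
move=> G; pose s p := ((coord p).2)^-1; pose m p := norm3 (coord p) / (coord p).2.
pose x p := (coord p).1.1 / (coord p).2; pose y p := (coord p).1.2 / (coord p).2.
have s0 p : 0 < s p by rewrite invr_gt0 coord_gt0.
have m0 p : 0 < m p.
  rewrite divr_gt0 ?coord_gt0 // norm3E ltr_wpDl ?addr_ge0 ?sqr_ge0 //.
  by rewrite exprn_gt0 ?coord_gt0.
have ms p : m p * s p = 1 + x p ^+ 2 + y p ^+ 2.
  rewrite /m /s /x /y norm3E.
  by field; rewrite lt0r_neq0 ?coord_gt0.
have GE p q : G p q = m p * s q + m q * s p - 2 * (x p * x q + y p * y q).
  rewrite /G /m /s /x /y !norm3E /=.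
  by field; rewrite !lt0r_neq0 ?(coord_gt0 p) ?(coord_gt0 q).
have sideE p : side p = m p - s p by rewrite /side mulrBl mul1r.
rewrite !GE !sideE => g1 g2 g3.
have [M0 S0] : a1 * m p1 + a2 * m p2 + a3 * m p3 = 0 /\ a1 * s p1 + a2 * s p2 + a3 * s p3 = 0.
  apply: (@null_orthogonal_timelike _ _ (a1 * x p1 + a2 * x p2 + a3 * x p3)
     (a1 * y p1 + a2 * y p2 + a3 * y p3) (m p1) (s p1) (x p1) (y p1)) => //.
    (* The sum of the relations weighted by the coefficients is the quadratic form at the
       combination, which is therefore null. *)
    move: (congr1 ( *%R a1) g1) (congr1 ( *%R a2) g2) (congr1 ( *%R a3) g3).
    by lra.
  by lra.
by split=> //; lra.
Qed.

(** Both sides are 2 cosh (u - v); quotients of exponentials keep later goals within reach of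
    [field]. *)
Lemma geodesic_mink gamma u v : geodesic gamma ->
  2 * (1 + norm3 (coord (gamma u) - coord (gamma v)) /
    (2 * (coord (gamma u)).2 * (coord (gamma v)).2)) =
  expR u / expR v + expR v / expR u.
Proof.
move=> /(_ u v); rewrite distE => /arcosh_eq -> //.
  rewrite -!expRN -!expRD; case: (ger0P (u - v)) => _; first by rewrite opprB.
  by rewrite opprK opprB addrC.
rewrite lerDl divr_ge0 ?norm3_ge0 // !mulr_ge0 // ltW // coord_gt0 //.
Qed.

(** A geodesic spans a two-dimensional subspace of Minkowski space, so any three of its points are
    linearly related; the coefficients are 2 sinh (v - w) and its cyclic images. *)
Lemma geodesic_three gamma u v w : geodesic gamma ->
  let a1 := expR v / expR w - expR w / expR v in
  let a2 := expR w / expR u - expR u / expR w in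
  let a3 := expR u / expR v - expR v / expR u in
  a1 * side (gamma u) + a2 * side (gamma v) + a3 * side (gamma w) = 0 /\
  a1 / (coord (gamma u)).2 + a2 / (coord (gamma v)).2 + a3 / (coord (gamma w)).2 = 0.
Proof.
move=> geo a1 a2 a3.
by apply: mink_sum; rewrite !(geodesic_mink _ _ geo) /a1 /a2 /a3; field;
   rewrite !gt_eqF ?expR_gt0.
Qed.

(** This is [geodesic_three] at equally spaced parameters, divided by 2 sinh v. *)
Lemma geodesic_midpoint gamma u v : geodesic gamma -> v != 0 ->
  let C := expR v + expR (- v) in
  side (gamma (u + v)) + side (gamma (u - v)) = C * side (gamma u) /\
  (coord (gamma (u + v))).2^-1 + (coord (gamma (u - v))).2^-1 = C / (coord (gamma u)).2.
Proof.
move=> geo v0 C; have [] := geodesic_three (u + v) u (u - v) geo.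
rewrite !expRD !expRN /C expRN.
have Eu := lt0r_neq0 (expR_gt0 u); have Ev := lt0r_neq0 (expR_gt0 v).
have Ev2 : (expR v) ^+ 2 != 1.
  by rewrite expr2 -expRD -expR0 (inj_eq (@expR_inj R)) -mulr2n mulrn_eq0.
move: (expR u) (expR v) Eu Ev Ev2 => e E Eu Ev Ev2.
have c0 : E - E^-1 != 0.
  by apply: contra Ev2; rewrite subr_eq0 expr2 => /eqP {1}->; rewrite mulVf.
move: (side (gamma (u + v))) (side _) (side _) (_.2^-1) (_.2^-1) (_.2^-1).
move=> f1 f0 f2 s1 s0 s2 a b; split; apply: (mulfI c0); apply/eqP; rewrite -subr_eq0.
  by apply/eqP; rewrite -[RHS]a; field; rewrite Eu Ev.
by apply/eqP; rewrite -[RHS]b; field; rewrite Eu Ev.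
Qed.

Lemma geodesic_side_odd gamma t : geodesic gamma -> plane (gamma 0) ->
  side (gamma (- t)) = - side (gamma t).
Proof.
move=> geo /planeP f0; have [->|t0] := eqVneq t 0; first by rewrite oppr0 f0 oppr0.
have [+ _] := geodesic_midpoint 0 geo t0.
by rewrite add0r sub0r f0 mulr0; lra.
Qed.

Lemma plane_convex : convex (@plane R).
Proof.
move=> gamma a b c geo /andP[ac cb] /planeP fa /planeP fb.
have [ab|ab] := eqVneq a b.
  have <- : a = c by apply/eqP; rewrite eq_le ac ab cb.
  exact/planeP.
(* Only the middle term survives, with coefficient 2 sinh (b - a). *)
apply/planeP; have [+ _] := geodesic_three a c b geo; rewrite fa fb !mulr0 add0r addr0.
move/eqP; rewrite mulf_eq0 => /orP[|/eqP //]; rewrite -!expRN -!expRD subr_eq0.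
move=> /eqP/expR_inj e; case/eqP: ab; lra.
Qed.

(** Within d of the unit circle, |side| is at most 3d / height. Since [side] and 1 / height obey the
    same midpoint relation, this bound passes from the two ends to every point of the geodesic, for
    each small d. *)
Lemma geodesic_joins_plane gamma zeta xi : geodesic gamma -> joins gamma zeta xi ->
  (exists2 w, zeta = Some w & normsq w = 1) -> (exists2 w, xi = Some w & normsq w = 1) ->
  range gamma `<=` @plane R.
Proof.
move=> geo jn [w zw w1] [w' xw w'1] _ [u _ <-]; subst zeta xi; apply/planeP.
(* The constant 3 comes from |p|^2 - 1 = |p - z|^2 + 2 z.(p - z), at most d^2 + 2d in absolute
   value. *)
have near_side (z : R[i]) d p : 0 < d -> d <= 1 -> normsq z = 1 -> near_boundary (Some z) d p ->
    `|side p| <= 3 * d / (coord p).2.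
  case: z => z1 z2 d0 d1; rewrite /normsq /= => z1' near.
  have t0 := coord_gt0 p; rewrite /side normrM normfV (gtr0_norm t0).
  rewrite ler_pM2r ?invr_gt0 // norm3E.
  move: near t0; rewrite /near_boundary /normsq /coord /base /height.
  case: p => -[[x y] t] /= _ near t0.
  set q := z1 * (x - z1) + z2 * (y - z2).
  have q2 : q ^+ 2 <= d ^+ 2.
    have : q ^+ 2 + (z1 * (y - z2) - z2 * (x - z1)) ^+ 2 =
      (z1 ^+ 2 + z2 ^+ 2) * ((x - z1) ^+ 2 + (y - z2) ^+ 2) by rewrite /q; ring.
    rewrite z1' mul1r; have := sqr_ge0 t.
    have := sqr_ge0 (z1 * (y - z2) - z2 * (x - z1)).
    lra.
  have : `|q| <= d.
    by rewrite -(ler_pXn2r (n := 2)) ?nnegrE ?normr_ge0 ?(ltW d0) // real_normK ?num_real.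
  have dd : d ^+ 2 <= d by rewrite expr2 ler_piMl // ltW.
  have nE : x ^+ 2 + y ^+ 2 + t ^+ 2 - 1 =
      (x - z1) ^+ 2 + (y - z2) ^+ 2 + t ^+ 2 + 2 * q.
    by rewrite -[X in _ - X = _]z1' /q; ring.
  rewrite nE !ler_norml => /andP[q_lo q_hi].
  have := sqr_ge0 (x - z1); have := sqr_ge0 (y - z2); have := sqr_ge0 t.
  by move: near; rewrite -/(_ ^+ 2); lra.
have le_d d : 0 < d -> d <= 1 -> `|side (gamma u)| <= 3 * d / (coord (gamma u)).2.
  move=> d0 d1; have [[m [mR lo]] [M [MR hi]]] := jn d d0.
  (* Large enough for u - v and u + v to lie in the two tails. *)
  pose v := 1 + `|u| + `|m| + `|M|.
  have v0 : 0 < v by rewrite /v -!addrA ltr_pwDl // !addr_ge0.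
  have um : u - v < m.
    rewrite /v; move: (ler_norm u) (ler_norm (- m)) (normr_ge0 M); rewrite normrN; lra.
  have uM : M < u + v.
    rewrite /v; move: (ler_norm (- u)) (ler_norm M) (normr_ge0 m); rewrite normrN; lra.
  have b1 := near_side _ _ _ d0 d1 w1 (lo _ um).
  have b2 := near_side _ _ _ d0 d1 w'1 (hi _ uM).
  have [e1 e2] := geodesic_midpoint u geo (lt0r_neq0 v0).
  have C0 : 0 < expR v + expR (- v) by rewrite addr_gt0 ?expR_gt0.
  rewrite -(ler_pM2l C0) -[X in X * `|_|](gtr0_norm C0) -normrM -e1.
  rewrite (le_trans (ler_normD _ _)) //.
  rewrite mulrCA -e2 mulrDr lerD //.
apply/eqP; rewrite -normr_le0; apply/ler_addgt0Pr => e e0; rewrite add0r.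
have t0 := coord_gt0 (gamma u); set t := (coord (gamma u)).2 in le_d t0.
have et0 : 0 < e * t / 3 by rewrite divr_gt0 // mulr_gt0.
apply: le_trans (le_d (Num.min 1 (e * t / 3)) _ _) _.
- by rewrite lt_min ltr01.
- by rewrite ge_min lexx.
by rewrite ler_pdivrMr // mulrC -ler_pdivlMr // ge_min lexx orbT.
Qed.

(** Along an orbit ||q|^2 - 1| is a constant times the height of q. The height tends to 0 near a
    finite limit point, and near infinity the equality fails by growth. *)
Lemma limit_set_circle (G : set (H3 R -> H3 R)) zeta :
  (forall g p, G g -> `|side (g p)| = `|side p|) -> limit_set G zeta ->
  exists2 w, zeta = Some w & normsq w = 1.
Proof.
move=> Gside [p lim].
have {}lim e : 0 < e -> exists q, [/\ `|norm3 (coord q) - 1| = `|side p| * (coord q).2,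
    near_boundary zeta e q & 0 < (coord q).2].
  move=> /lim [q [g Gg gp] near]; exists q; split=> //; last exact: coord_gt0.
  rewrite -(Gside g p Gg) gp /side normrM normfV (gtr0_norm (coord_gt0 q)).
  by rewrite mulfVK // lt0r_neq0 // coord_gt0.
case: zeta lim => [[z1 z2]|] lim.
  exists (z1 +i* z2)%C => //; apply/eqP; rewrite -subr_eq0 -normr_le0.
  (* The three terms bound, in units of d, the contributions of the height, of |q - z|^2 and of 2
     z.(q - z). *)
  pose K := `|side p| + 1 + 2 * (`|z1| + `|z2|).
  have K0 : 0 < K.
    by rewrite /K addrAC ltr_wpDl // addr_ge0 // mulr_ge0 // addr_ge0.
  apply/ler_addgt0Pr => e e0; rewrite add0r.
  have eK0 : 0 < e / K by rewrite divr_gt0.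
  have [d [d0 d1 dK]] : exists d, [/\ 0 < d, d <= 1 & d * K <= e].
    exists (Num.min 1 (e / K)); rewrite lt_min ltr01 eK0 ge_min lexx; split=> //.
    by rewrite -ler_pdivlMr // ge_min lexx orbT.
  have [q [+ + +]] := lim d d0; rewrite norm3E /near_boundary /normsq /coord /base /height.
  move: dK; rewrite /K; move: `|side p| (normr_ge0 (side p)) => C C0 dK.
  case: q => -[[x y] t] /= _ nE near t0.
  have small u : u ^+ 2 <= d ^+ 2 -> `|u| <= d.
    by rewrite -(ler_pXn2r (n := 2) _ (normr_ge0 u)) ?nnegrE ?(ltW d0) // real_normK ?num_real.
  have q1 := sqr_ge0 (x - z1); have q2 := sqr_ge0 (y - z2); have q3 := sqr_ge0 t.
  have dx : `|x - z1| <= d by apply: small; lra.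
  have dy : `|y - z2| <= d by apply: small; lra.
  have dt : t <= d by rewrite -(gtr0_norm t0); apply: small; lra.
  have -> : z1 ^+ 2 + z2 ^+ 2 - 1 = (x ^+ 2 + y ^+ 2 + t ^+ 2 - 1) -
     ((x - z1) ^+ 2 + (y - z2) ^+ 2 + t ^+ 2) - 2 * (z1 * (x - z1) + z2 * (y - z2)) by ring.
  have b1 : `|z1 * (x - z1)| <= `|z1| * d by rewrite normrM ler_wpM2l.
  have b2 : `|z2 * (y - z2)| <= `|z2| * d by rewrite normrM ler_wpM2l.
  have b3 : C * t <= C * d by rewrite ler_wpM2l.
  have b4 : d ^+ 2 <= d by rewrite expr2 ler_piMl // ltW.
  rewrite -nE in b3; move: b1 b2 b3; rewrite !ler_norml.
  move=> /andP[? ?] /andP[? ?] /andP[? ?]; apply/andP; split; lra.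
(* With C = [side p ^+ 2] and n = |q|^2 >= 2 + C, one has (n - 1)^2 > C n, whereas the orbit
   relation gives (n - 1)^2 <= C n. *)
pose m := 2 + side p ^+ 2.
have m0 : 0 < m by rewrite ltr_wpDr ?sqr_ge0.
have [|q []] := lim m^-1; first by rewrite invr_gt0.
rewrite norm3E /near_boundary exprVn invrK /normsq /coord /base /height.
case: q => -[[x y] t] /= _ nE near t0.
have : (x ^+ 2 + y ^+ 2 + t ^+ 2 - 1) ^+ 2 = side p ^+ 2 * t ^+ 2.
  by rewrite -real_normK ?num_real // nE exprMn real_normK ?num_real.
have nm : m <= x ^+ 2 + y ^+ 2 + t ^+ 2.
  rewrite (le_trans _ (ltW near)) // expr2 ler_peMl ?(ltW m0) // /m.
  by have := sqr_ge0 (side p); lra.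
move: nm near; have : t ^+ 2 <= x ^+ 2 + y ^+ 2 + t ^+ 2 by rewrite lerDr addr_ge0 ?sqr_ge0.
rewrite /m; move: (side p ^+ 2) (sqr_ge0 (side p)) (t ^+ 2) (sqr_ge0 t) (x ^+ 2 + y ^+ 2 + t ^+ 2).
move=> C C0 T T0 n Tn nm _ e.
have : C * T <= C * n by rewrite ler_wpM2l.
have : n * (2 + C) <= n * n by rewrite ler_wpM2l //; lra.
by move: e; rewrite expr2; lra.
Qed.

Lemma core_plane (G : set (H3 R -> H3 R)) :
  (forall g p, G g -> `|side (g p)| = `|side p|) -> core G `<=` @plane R.
Proof.
move=> Gside p; apply; first exact: plane_convex.
move=> gamma zeta xi /(limit_set_circle Gside) z1 /(limit_set_circle Gside) x1 geo jn.
exact: geodesic_joins_plane geo jn z1 x1.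
Qed.

End Geodesics.

(** * Action of a half-turn on normals, the core and the strips *)

Section PlaneTurns.
Variables (R : realType) (h : H3 R -> H3 R).
Implicit Types (p q : H3 R) (gamma delta : R -> H3 R) (X S : set (H3 R)).
Hypothesis turnh : plane_turn h.
Hypothesis hK : forall p, h (h p) = p.

Lemma coord_neq_centre p (a b : R) : coord p != (a, b, 0).
Proof.
apply/eqP => e; have := coord_gt0 p; rewrite e /=.
by rewrite ltxx.
Qed.

(** The squared Euclidean distance and the product of the heights are divided by the same product of
    radius factors. *)
Lemma plane_turn_dist p q : dist (h p) (h q) = dist p q.
Proof.
have [k [a [b [c [s [data hE]]]]]] := turnh.
rewrite !distE !hE (turn_norm3B data) ?coord_neq_centre //.
rewrite !turn_height; congr (arcosh (1 + _)).
have := lt0r_neq0 (radius_gt0 data (coord_neq_centre p a b)).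
have := lt0r_neq0 (radius_gt0 data (coord_neq_centre q a b)).
set r := k * _; set r' := k * _ => r0 r'0.
by field; rewrite r0 r'0 !lt0r_neq0 ?(coord_gt0 p) ?(coord_gt0 q).
Qed.

Lemma plane_turn_geodesic gamma : geodesic gamma -> geodesic (h \o gamma).
Proof. by move=> geo u v; rewrite plane_turn_dist geo. Qed.

Lemma geodesic_opp gamma : geodesic gamma -> geodesic (fun t => gamma (- t)).
Proof. by move=> geo u v; rewrite geo opprK addrC distrC. Qed.

Lemma plane_turn_side p : side (h p) = - side p.
Proof.
have [k [a [b [c [s [data hE]]]]]] := turnh.
rewrite /side !hE (turn_norm3 data) ?coord_neq_centre //.
rewrite turn_height.
have := lt0r_neq0 (radius_gt0 data (coord_neq_centre p a b)).
set r := k * _ => r0; have t0 := lt0r_neq0 (coord_gt0 p).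
by field; rewrite r0 t0.
Qed.

Lemma plane_turn_plane p : plane p -> plane (h p).
Proof. by move=> /planeP f0; apply/planeP; rewrite plane_turn_side f0 oppr0. Qed.

Lemma plane_turn_orthogonal gamma delta :
  orthogonal_at0 gamma delta -> orthogonal_at0 (h \o gamma) (h \o delta).
Proof.
have [k [a [b [c [s [data hE]]]]]] := turnh.
move=> [e0 [v [w [vv vw vw0]]]]; split=> /=; first by rewrite e0.
exists (dturn k a b c s (coord (gamma 0)) v), (dturn k a b c s (coord (delta 0)) w); split.
- by apply: (velocity_turn data _ _ vv) => [|t]; [exact: coord_neq_centre|exact: hE].
- by apply: (velocity_turn data _ _ vw) => [|t]; [exact: coord_neq_centre|exact: hE].
- by rewrite -e0 (dot_dturn data) ?coord_neq_centre // vw0 mul0r.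
Qed.

Lemma orthogonal_at0_opp gamma delta :
  orthogonal_at0 gamma delta -> orthogonal_at0 (fun t => gamma (- t)) delta.
Proof.
move=> [e0 [v [w [[d1 d2 d3] vw vw0]]]]; split; first by rewrite oppr0.
exists (- v), w; split=> //; last first.
  by rewrite -[RHS]oppr0 -vw0 /dot /=; ring.
have flip (F : R -> R) (dF : R) : is_derive (0 : R) 1 F dF -> is_derive (0 : R) 1 (fun t => F (- t)) (- dF).
  move=> dF0; have := @is_derive1_comp R F -%R 0 dF (-1).
  rewrite oppr0 mulrN1; apply=> //; exact: is_deriveNid.
by split; apply: (flip (fun t => _)).
Qed.

Lemma plane_turn_normal x gamma : plane x -> normal x gamma ->
  normal (h x) (fun t => h (gamma (- t))).
Proof.
move=> Px [geo g0 orth ext]; split.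
- exact: (plane_turn_geodesic (geodesic_opp geo)).
- by rewrite oppr0 g0.
- move=> delta gdelta d0 dP.
  (* Orthogonality is known at [x], so [delta] is moved there by [h] and the conclusion is moved
     back. *)
  have o : orthogonal_at0 gamma (h \o delta).
    apply: orth; first exact: plane_turn_geodesic.
      by rewrite /= d0 hK.
    by move=> _ [t _ <-]; apply/plane_turn_plane/dP; exists t.
  have := plane_turn_orthogonal (orthogonal_at0_opp o).
  congr (orthogonal_at0 _ _); apply/funext => t /=; exact: hK.
(* [h] negates [side], and so does reversing [gamma]; the signs cancel. *)
- move=> t t0; apply/exteriorP; rewrite plane_turn_side.
  rewrite (geodesic_side_odd _ geo) ?g0 // opprK.
  exact/exteriorP/ext.
Qed.

Lemma plane_turn_push X (s : R) q : X `<=` @plane R -> (forall p, X p -> X (h p)) ->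
  push X s q -> push X (- s) (h q).
Proof.
move=> XP hX [x [gamma [Xx nx ->]]].
exists (h x), (fun t => h (gamma (- t))); split; first exact: hX.
  exact: plane_turn_normal (XP _ Xx) nx.
by rewrite opprK.
Qed.

(** Components are taken in coordinates, so the connected witness is moved by [turn], which is
    continuous away from its centre, a point of height 0. *)
Lemma plane_turn_component S p q : (forall x, S x -> S (h x)) ->
  same_component S p q -> same_component S (h p) (h q).
Proof.
have [k [a [b [c [s [data hE]]]]]] := turnh.
move=> hS [C [Cp CS Ccon] Cq].
exists (turn k a b c s @` C); last by rewrite hE; exists (coord q).
split.
- by rewrite hE; exists (coord p).
- move=> _ [y Cy <-]; have [x Sx <-] := CS _ Cy.
  by rewrite -hE; exists (h x) => //; exact: hS.
- apply: connected_continuous_connected => //.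
  apply: continuous_in_subspaceT => y /[1!inE] /CS [x _ <-].
  apply: (turn_continuous data); exact: coord_neq_centre.
Qed.

Lemma near_boundaryE (w : R[i]) (e : R) p : near_boundary (Some w) e p =
  (norm3 (coord p - (complex.Re w, complex.Im w, 0)) < e ^+ 2).
Proof.
rewrite norm3E /near_boundary /normsq /coord /base /height /= subr0.
by case: p => -[[? ?] ?] /= _; case: w.
Qed.

(** A triangle inequality free of square roots: the gap between the sides is the squared norm of (x
    - y) + (x - z). *)
Lemma norm3_sub_le (x y z : R * R * R) :
  norm3 (y - z) <= 2 * norm3 (x - y) + 2 * norm3 (x - z).
Proof.
rewrite !norm3E /=; move: x y z => -[[x1 x2] x3] [[y1 y2] y3] [[z1 z2] z3] /=.
have := sqr_ge0 ((x1 - y1) + (x1 - z1)); have := sqr_ge0 ((x2 - y2) + (x2 - z2)).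
have := sqr_ge0 ((x3 - y3) + (x3 - z3)); lra.
Qed.

(** [turn] also acts on the boundary circle, which avoids its centre, and [turn_norm3B] gives an
    explicit modulus of continuity there. *)
Lemma plane_turn_near (w : R[i]) : normsq w = 1 ->
  exists w', forall e, 0 < e -> exists2 d, 0 < d &
    forall p, near_boundary (Some w) d p -> near_boundary (Some w') e (h p).
Proof.
have [k [a [b [c [s [data hE]]]]]] := turnh.
case: w => w1 w2 n1; rewrite /normsq /= in n1.
set f := turn k a b c s in hE *; pose x : R * R * R := (w1, w2, 0).
have xn : x != (a, b, 0).
  apply/eqP => -[ea eb]; case: data => k0 ck _ _ _; move: ck.
  by rewrite -ea -eb (_ : 1 - _ - _ = 0) ?mulr0; [lra|rewrite -n1; ring].
have fx2 : (f x).2 = 0 by rewrite /f turn_height /= mul0r.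
exists ((f x).1.1 +i* (f x).1.2)%C => e e0.
pose N := norm3 (x - (a, b, 0)); have k0 : 0 < k by case: data.
have N0 : 0 < N by have := radius_gt0 data xn; rewrite (pmulr_rgt0 _ k0).
(* The first bound keeps p at squared distance at least N / 4 from the centre; the second then makes
   the image distance less than e. *)
pose d := Num.min (Num.min 1 N / 2) (e * k * N / 2).
have d0 : 0 < d by rewrite /d !lt_min !divr_gt0 ?lt_min ?ltr01 ?N0 // !mulr_gt0.
have d1 : d ^+ 2 <= N / 4.
  have m1 : Num.min 1 N <= 1 by rewrite ge_min lexx.
  have m2 : Num.min 1 N <= N by rewrite ge_min lexx orbT.
  have m0 : 0 < Num.min 1 N by rewrite lt_min ltr01.
  have dm : d <= Num.min 1 N / 2 by rewrite /d ge_min lexx.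
  have : d ^+ 2 <= (Num.min 1 N / 2) ^+ 2 by rewrite ler_pXn2r // nnegrE ltW // divr_gt0.
  have : Num.min 1 N * Num.min 1 N <= N by rewrite (le_trans _ m2) // ler_piMl // ltW.
  by move: (Num.min 1 N) => m; nra.
have d2 : d ^+ 2 <= e ^+ 2 * (k * (N / 4) * (k * N)).
  have dm : d <= e * k * N / 2 by rewrite /d ge_min lexx orbT.
  have : d ^+ 2 <= (e * k * N / 2) ^+ 2.
    by rewrite ler_pXn2r // nnegrE ltW // divr_gt0 // !mulr_gt0.
  by nra.
exists d => // p; rewrite !near_boundaryE hE /= -/x.
have -> : ((f x).1.1, (f x).1.2, 0) = f x by rewrite -fx2; case: (f x) => -[].
move=> px; rewrite /f (turn_norm3B data) ?coord_neq_centre //.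
have pN : N / 4 <= norm3 (coord p - (a, b, 0)).
  have := norm3_sub_le (coord p) x (a, b, 0); rewrite -/N; lra.
have r0 : 0 < k * (N / 4) * (k * N) by rewrite !mulr_gt0 // divr_gt0.
have r1 : k * (N / 4) * (k * N) <= k * norm3 (coord p - (a, b, 0)) * (k * N).
  by rewrite ler_pM2r ?mulr_gt0 // ler_pM2l.
rewrite ltr_pdivrMr ?(lt_le_trans r0) //.
by rewrite (lt_le_trans px) // (le_trans d2) // ler_wpM2l // sqr_ge0.
Qed.

Variable G : set (H3 R -> H3 R).
Hypothesis Gside : forall g p, G g -> `|side (g p)| = `|side p|.
Hypothesis orbit_h : forall p, exists q, h @` orbit G p `<=` orbit G q.

(** The preimage under [h] of a set admissible in the definition of the hull is admissible, because
    [h] preserves geodesics and sends limit points to limit points. *)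
Lemma plane_turn_core p : core G p -> core G (h p).
Proof.
move=> Cp K cK limK.
have := Cp [set q | K (h q)]; apply.
  by move=> gamma a b c geo abc; exact: (cK _ _ _ _ (plane_turn_geodesic geo) abc).
move=> gamma zeta xi Lz Lx geo jn _ [t _ <-] /=.
have image z : limit_set G z -> exists z', limit_set G z' /\
    forall e, 0 < e -> exists2 d, 0 < d &
      forall p, near_boundary z d p -> near_boundary z' e (h p).
  move=> Lz'; have [w zw w1] := limit_set_circle Gside Lz'; subst z.
  have [w' near] := plane_turn_near w1; exists (Some w'); split=> //.
  have [q lim] := Lz'; have [q' hq] := orbit_h q; exists q' => e e0.
  have [d d0 neard] := near e e0; have [y Gy yd] := lim d d0.
  by exists (h y); [apply: hq; exists y|exact: neard].
have [z' [Lz' near_z]] := image _ Lz; have [x' [Lx' near_x]] := image _ Lx.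
suff sub : range (h \o gamma) `<=` K by apply: sub; exists t.
apply: limK Lz' Lx' (plane_turn_geodesic geo) _.
move=> e e0; have [d d0 dz] := near_z e e0; have [d' d'0 dx] := near_x e e0.
split; [have [+ _] := jn d d0|have [_ +] := jn d' d'0]; apply: filterS => u.
  exact: dz.
exact: dx.
Qed.

Lemma plane_turn_push_core (s : R) q : push (core G) s q -> push (core G) (- s) (h q).
Proof. exact: plane_turn_push (core_plane Gside) plane_turn_core. Qed.

Section InvertedElement.
Variable W : H3 R -> H3 R.
Hypothesis WhW : forall p, W (h (W p)) = h p.

(** [WhW] says that [h] conjugates [W] to its inverse. The image of a translated geodesic is thus
    translated backwards, and reversing its parameter makes the length positive again. *)
Lemma plane_turn_axis p : axis W p -> axis W (h p).
Proof.
move=> [gamma [l [geo l0 Wg [t _ <-]]]].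
exists (fun t => h (gamma (- t))), l; split=> //.
- exact: plane_turn_geodesic (geodesic_opp geo).
- by move=> u; rewrite -[in LHS](subrK l (- u)) -Wg WhW opprD.
- by exists (- t) => //; rewrite opprK.
Qed.

Lemma plane_turn_Eq (s : R) p : Eq W s p -> Eq W s (h p).
Proof.
rewrite /Eq /= => <-; congr inf; apply/seteqP; split=> _ [q aq <-].
  by exists (h q); [exact: plane_turn_axis|rewrite -plane_turn_dist hK].
by exists (h q); [exact: plane_turn_axis|rewrite plane_turn_dist].
Qed.

Lemma plane_turn_Eq_cut (s : R) p : Eq_cut W s p -> Eq_cut W s (h p).
Proof.
move=> [Ep np]; split; first exact: plane_turn_Eq.
have back t : push (@plane R) t (h p) -> push (@plane R) (- t) p.
  by move=> /(plane_turn_push (fun _ => id) plane_turn_plane); rewrite hK.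
case=> /back pp; apply: np; [right|left] => //.
by rewrite opprK in pp.
Qed.

Lemma plane_turn_Rec (s : R) p : Rec G W s p -> Rec G W s (h p).
Proof.
have move_strip := plane_turn_component (@plane_turn_Eq_cut s).
move=> [_ [[q Eq_q ->] disj qp]].
exists (same_component (Eq_cut W s) (h q)); split.
- by exists (h q) => //; exact: plane_turn_Eq_cut.
(* [h] would send a core point of the moved strip back to a core point of the original one. *)
- rewrite -subset0 => y [/move_strip + Cy]; rewrite hK => qy.
  suff : set0 (h y) by [].
  by rewrite -disj; split; [exact: qy|exact: plane_turn_core].
- exact: move_strip.
Qed.

End InvertedElement.

End PlaneTurns.

(** * Words in the generators and points of the quotient *)

Section Words.
Variable R : realType.
Implicit Types (a b g h : H3 R -> H3 R) (w : seq (bool * bool)).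

Lemma line_half_turn_plane_turn (L : set (H3 R)) h :
  line L -> L `<=` @plane R -> half_turn L h -> plane_turn h.
Proof.
move=> [gamma geo ->] LP ht.
have on t : range gamma (gamma t) by exists t.
apply: (half_turn_plane_turn ht (on 0) (on 1)); [|exact: LP..].
move=> e; have := geo 0 0; rewrite {2}e geo !sub0r normrN normr1 oppr0 normr0.
by move/eqP; rewrite oner_eq0.
Qed.

(** [inv] selects a preimage by choice; injectivity of [g] makes that preimage unique. *)
Lemma inv_cancel g g' : cancel g' g -> cancel g g' -> inv g = g'.
Proof.
move=> gg' g'g; apply/funext => p; apply: xget_unique; first exact: gg'.
by move=> q /= <-; rewrite g'g.
Qed.

Lemma word_flip a b h w p :
  (forall q, h (a q) = inv a (h q)) -> (forall q, h (inv a q) = a (h q)) ->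
  (forall q, h (b q) = inv b (h q)) -> (forall q, h (inv b q) = b (h q)) ->
  h (word a b w p) = word a b [seq (l.1, ~~ l.2) | l <- w] (h p).
Proof. by move=> ha ha' hb hb'; elim: w => //= -[[] []] w IH /=; rewrite -IH. Qed.

Lemma word_side a b w p :
  (forall q, side (a q) = side q) -> (forall q, side (inv a q) = side q) ->
  (forall q, side (b q) = side q) -> (forall q, side (inv b q) = side q) ->
  side (word a b w p) = side p.
Proof. by move=> ha ha' hb hb'; elim: w => //= -[[] []] w /= <-. Qed.

Lemma projP (G : set (H3 R -> H3 R)) (O : quotient G) : exists p, O = proj G p.
Proof.
case: O => O [p Op]; exists p; subst O.
by congr (exist _ _ _); apply: Prop_irrelevance.
Qed.

End Words.

(** * Invariance of the surface under [j], piece by piece *)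

Theorem proposition7p1 (R : realType) (G : set (H3 R -> H3 R))
    (A B : H3 R -> H3 R) (L LA LB : set (H3 R)) (HL HLA HLB : H3 R -> H3 R)
    (j : quotient G -> quotient G) (s : R) :
  fuchsian G -> free_rank2 G -> no_parabolic G ->
  stopping G A B L LA LB HL HLA HLB ->
  hyperelliptic HL HLA HLB j ->
  0 < s ->
  j @` surface G A B s = surface G A B s.
Proof.
move=> _ _ _ [[[_ _ GE] _] [[lL lLA lLB] [LP LAP LBP]] _
  [[hL hLA hLB] [AE BE]] _] [jL jLA jLB] _.
have tL := line_half_turn_plane_turn lL LP hL.
have tLA := line_half_turn_plane_turn lLA LAP hLA.
have tLB := line_half_turn_plane_turn lLB LBP hLB.
have LK p : HL (HL p) = p by case: hL => _ _ e _; rewrite -[LHS]/((HL \o HL) p) e.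
have LAK p : HLA (HLA p) = p by case: hLA => _ _ e _; rewrite -[LHS]/((HLA \o HLA) p) e.
have LBK p : HLB (HLB p) = p by case: hLB => _ _ e _; rewrite -[LHS]/((HLB \o HLB) p) e.
have invA : inv A = HLA \o HL by apply: inv_cancel => p; rewrite AE /= ?LAK ?LK ?LAK.
have invB : inv B = HLB \o HL by apply: inv_cancel => p; rewrite BE /= ?LBK ?LK ?LBK.
(* Each generator is a product of two half-turns, so the sign changes of [side] cancel. *)
have Gside g p : G g -> `|side (g p)| = `|side p|.
  rewrite GE => -[w _ <-]; congr `|_|; apply: word_side => q;
    by rewrite ?invA ?invB ?AE ?BE /= !plane_turn_side // opprK.
have flip w p : HL (word A B w p) = word A B [seq (l.1, ~~ l.2) | l <- w] (HL p).
  by apply: word_flip => q; rewrite ?invA ?invB ?AE ?BE /= ?LK.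
have orbL p : exists q, HL @` orbit G p `<=` orbit G q.
  exists (HL p) => _ [_ [g + <-] <-]; rewrite GE => -[w _ <-]; rewrite flip.
  by exists (word A B [seq (l.1, ~~ l.2) | l <- w]).
have orbLA p : exists q, HLA @` orbit G p `<=` orbit G q.
  exists (HL p) => _ [_ [g + <-] <-]; rewrite GE => -[w _ <-].
  (* Since [HLA = inv A \o HL], the flipped word is preceded by the letter for [inv A]. *)
  pose w' := (false, true) :: [seq (l.1, ~~ l.2) | l <- w].
  have -> : HLA (word A B w p) = word A B w' (HL p).
    by rewrite /= -flip invA /= LK.
  by exists (word A B w').
have RecA := plane_turn_Rec tL LK Gside orbL (W := A).
have RecB := plane_turn_Rec tL LK Gside orbL (W := B).
(* [inv A \o B] equals [HLA \o HLB], so the half-turn that inverts it here is [HLA]; orbits see the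
   same [j]. *)
have RecAB := plane_turn_Rec tLA LAK Gside orbLA (W := inv A \o B).
have js x : surface G A B s x -> surface G A B s (j x).
  case=> [[[[[p Ep <-]|[p Ep <-]]|[p Ep <-]]|[p Ep <-]]|[p Ep <-]].
  - rewrite jL; do 3 left; right; exists (HL p) => //.
    exact: plane_turn_push_core.
  - rewrite jL; do 4 left; exists (HL p) => //.
    by rewrite -[s]opprK; exact: plane_turn_push_core.
  - rewrite jL; do 2 left; right; exists (HL p) => //.
    by apply: RecA Ep => q; rewrite AE /= LK LAK.
  - rewrite jL; left; right; exists (HL p) => //.
    by apply: RecB Ep => q; rewrite BE /= LK LBK.
  - rewrite jLA; right; exists (HLA p) => //.
    by apply: RecAB Ep => q; rewrite invA BE /= !LK LAK LBK.
(* As [j] is an involution, the inclusion [js] yields equality. *)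
have jK x : j (j x) = x by have [p xE] := projP x; rewrite xE !jL LK.
apply/seteqP; split=> [_ [x Sx <-]|x Sx]; first exact: js.
by exists (j x); [exact: js|exact: jK].
Qed.
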